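(* Let $\mathcal{X}=\mathbb{N}$, $\mathcal{Y}=\{0,1\}$, $\Phi=\{0,1\}^{\mathcal{X}}$ and $H_\bullet=\{(2,0),(1,1)\}$. For every integer $d\geq2$ there is a teacher class $\mathcal{T}^d$ over $\mathcal{X},\mathcal{Y},\Phi$ such that $\mathrm{DFFdim}(\mathcal{T}^d,H_\bullet)\leq d$ and, for every $k\geq1$, every $L\geq4(k+1)d$ and every (possibly randomized) DFF algorithm $\mathcal{A}$, \[M^L_k(\mathcal{A},\mathcal{T}^d,H_\bullet)\geq(k+1)d-k-2.\]
   Context: Setting. A teacher over $\mathcal{X},\mathcal{Y},\Phi$ ($\bot$ a null symbol) is a pair $T=(\ell,\psi)$ with $\ell:\mathcal{X}\to\mathcal{Y}$ and $\psi:\mathcal{X}\times\mathcal{X}\to\Phi\cup\{\bot\}$ such that whenever $\ell(x)\neq\ell(\hat x)$, $\phi:=\psi(x,\hat x)\in\Phi$, $\phi(x)=1$ and $\phi(\hat x)=0$. A teacher class is a set of teachers. A history is a non-empty $H\subseteq\mathcal{X}\times\mathcal{Y}$; a teacher $(\ell,\psi)$ is consistent with $H$ if $\ell(x)=y$ for all $(x,y)\in H$; $\mathcal{T}_H$ is the set of teachers in $\mathcal{T}$ consistent with $H$. DFF protocol. A DFF algorithm is given $H$ in advance. In each round $t$: an example $x_t$ arrives; the algorithm outputs $(\hat x_t,\hat y_t)\in H\cup\{(x_s,y_s):s<t\}$; if $\hat y_t=y_t$ (the provided label of $x_t$) it learns only that it was correct; otherwise (a mistake) it receives $y_t$ and a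 feature $\phi_t$. DFF dimension. A DFF tree is a rooted tree whose nodes are triples $\langle y,\phi,x\rangle$ with $y\in\mathcal{Y}\cup\{\bot\}$, $\phi\in\Phi\cup\{\bot\}$, $x\in\mathcal{X}\cup\{\bot\}$, such that the root has $y=\phi=\bot$, a node has $x=\bot$ iff it is a leaf, every edge is labeled by a pair $(\hat x,\hat y)\in\mathcal{X}\times\mathcal{Y}$, and every non-root node $\langle y,\phi,x\rangle$ with incoming edge $(\hat x,\hat y)$ has $\phi\neq\bot$ whenever $y\neq\hat y$. For a parent–child pair $\langle\cdot,\cdot,x\rangle\xrightarrow{(\hat x,\hat y)}\langle y,\phi,\cdot\rangle$ on a path, $(x,y)$ is called a labeled example in that path. A path from the root is consistent with a teacher $(\ell,\psi)$ if for every such parent–child pair on it, $\ell(x)=y$ and, if $y\neq\hat y$, $\psi(x,\hat x)=\phi$. Given $\mathcal{T}$ consistent with $H$, a DFF tree is shattered by $\mathcal{T}$ and $H$ if: (1) every non-root node $\langle y,\phi,x\rangle$ with incoming edge $(\hat x,\hat y)$ has $y\neq\hat y$; (2) the labels of the outgoing edges of each non-leaf node $v$ are exactly the pairs that belong to $H$ or are labeled examples in the path from the root to $v$; (3) every root-to-leaf path is consistent with some teacher in $\mathcal{T}_H$; (4) all root-to-leaf paths have the same number of edges, called the height. $\mathrm{DFFdim}(\mathcal{T},H)$ is the maximal height of a DFF tree shattered by $\mathcal{T}$ and $H$. Non-realizable mistake bound with adaptive adversary. An interaction over $L$ rounds produces $S=((x_t,y_t,\hat x_t,\hat y_t,\phi_t))_{t\in[L]}$,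 with $\phi_t=\bot$ when $\hat y_t=y_t$. An adversary, in each round $t$, chooses $(x_t,y_t,\psi_t)$ with $\psi_t:\mathcal{X}\times\mathcal{X}\to\Phi\cup\{\bot\}$ as a function of the past interaction $S_{t-1}$; then the algorithm chooses $(\hat x_t,\hat y_t)$ (possibly randomly) as a function of $S_{t-1}$ and $x_t$; then, if $\hat y_t\neq y_t$, $\phi_t=\psi_t(x_t,\hat x_t)$ is revealed together with $y_t$. $S$ is $k$-consistent with a teacher $(f,\psi)$ if there is $E\subseteq[L]$, $|E|\leq k$, such that for all $t\in[L]\setminus E$, $f(x_t)=y_t$ and, if $\hat y_t\neq y_t$, $\psi(x_t,\hat x_t)=\phi_t$. $M^L_k(\mathcal{A},\mathcal{T},H)$ is the supremum, over all adversaries whose interaction with $\mathcal{A}$ produces with probability $1$ a sequence that is $k$-consistent with some teacher in $\mathcal{T}_H$, of the expected number of mistakes of $\mathcal{A}$ over $L$ rounds. *)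

(* Defs.v *)
From HB Require Import structures.
From mathcomp Require Import all_boot all_order all_algebra.
From mathcomp Require Import boolp classical_sets reals constructive_ereal ereal.
From mathcomp Require Import Rstruct.
From Stdlib Require Rdefinitions.
Notation R := Rdefinitions.R.

Set Implicit Arguments.
Unset Strict Implicit.
Unset Printing Implicit Defensive.
Import Order.TTheory GRing.Theory Num.Theory.

(* Instance: X = nat, Y = bool ({0,1}, 1 = true), Phi = nat -> bool.
   Phi \cup {bot} is rendered as option (nat -> bool), None = bot. *)
Definition feature := nat -> bool.

Definition teacher := ((nat -> bool) * (nat -> nat -> option feature))%type.

Definition is_teacher (T : teacher) : Prop :=
  forall x xh : nat, T.1 x <> T.1 xh ->
    exists phi : feature, T.2 x xh = Some phi /\ phi x = true /\ phi xh = false.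

Definition teacher_class := teacher -> Prop.

Definition is_teacher_class (TC : teacher_class) : Prop :=
  forall T, TC T -> is_teacher T.

(* A history is a (non-empty) set of labeled examples, given as a list. *)
Definition history := list (nat * bool).

Definition consistent_with (T : teacher) (H : history) : Prop :=
  forall xy, List.In xy H -> T.1 xy.1 = xy.2.

Definition restrict (TC : teacher_class) (H : history) : teacher_class :=
  fun T => TC T /\ consistent_with T H.

Definition H_bullet : history := [:: (2%N, false); (1%N, true)].

(* Nodes <y, phi, x>.  A leaf is exactly a node with x = bot, so leaves
   carry no x; inner nodes carry x and, for each edge label (xh, yh),
   optionally a child (kid l = Some c iff there is an outgoing edge with
   label l leading to c). *)
Inductive dfftree : Type :=
| DLeaf (y : option bool) (phi : option feature)
| DNode (y : option bool) (phi : option feature) (x : nat)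
        (kid : nat * bool -> option dfftree).

Definition node_y (t : dfftree) : option bool :=
  match t with DLeaf y _ => y | DNode y _ _ _ => y end.
Definition node_phi (t : dfftree) : option feature :=
  match t with DLeaf _ phi => phi | DNode _ phi _ _ => phi end.

(* One parent-child step of a path:
   <., ., px> --(lbl)--> <cy, cphi, .> *)
Record step := Step {
  px : nat;
  lbl : nat * bool;
  cy : option bool;
  cphi : option feature }.

Inductive reach (t : dfftree) : list step -> dfftree -> Prop :=
| reach_root : reach t [::] t
| reach_step p y phi x kid l c :
    reach t p (DNode y phi x kid) -> kid l = Some c ->
    reach t (rcons p (Step x l (node_y c) (node_phi c))) c.

Definition is_dfftree (t : dfftree) : Prop :=
  [/\ node_y t = None, node_phi t = None,
      (forall p s c, reach t (rcons p s) c -> cy s <> Some (lbl s).2 -> cphi s <> None)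
    &
      (forall p y phi x kid, reach t p (DNode y phi x kid) -> exists l, kid l <> None)].

Definition labeled (p : list step) : list (nat * option bool) :=
  map (fun s => (px s, cy s)) p.

Definition path_consistent (T : teacher) (p : list step) : Prop :=
  forall s, List.In s p ->
    Some (T.1 (px s)) = cy s /\
    (cy s <> Some (lbl s).2 -> T.2 (px s) (lbl s).1 = cphi s).

Definition shattered (TC : teacher_class) (H : history) (t : dfftree) (h : nat) : Prop :=
  [/\ is_dfftree t,
      (forall p s c, reach t (rcons p s) c -> cy s <> Some (lbl s).2),
      (forall p y phi x kid, reach t p (DNode y phi x kid) ->
         forall l, kid l <> None <-> (List.In l H \/ List.In (l.1, Some l.2) (labeled p))),
      (forall p y phi, reach t p (DLeaf y phi) ->
         exists T, restrict TC H T /\ path_consistent T p)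
    &
      (forall p y phi, reach t p (DLeaf y phi) -> size p = h)].

Definition DFFdim_le (TC : teacher_class) (H : history) (d : nat) : Prop :=
  forall t h, shattered TC H t h -> (h <= d)%N.

Record entry := Entry {
  ex : nat; ey : bool; exh : nat; eyh : bool; ephi : option feature }.

Definition entry0 : entry := Entry 0 false 0 false None.

Definition interaction := list entry.

(* A (possibly randomized) DFF algorithm: given the past interaction
   S_{t-1} and x_t, a finitely supported probability distribution
   (list of weight/outcome pairs) over outputs (xh_t, yh_t). *)
Definition dff_alg := interaction -> nat -> list (R * (nat * bool)).

Definition valid_alg (H : history) (A : dff_alg) : Prop :=
  forall S x,
    (forall wo, List.In wo (A S x) ->
       (0 <= wo.1 :> R)%R /\
       (List.In wo.2 H \/ List.In wo.2 (map (fun e => (ex e, ey e)) S))) /\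
    (\sum_(wo <- A S x) wo.1 = 1)%R.

Definition adversary := interaction -> nat * bool * (nat -> nat -> option feature).

Definition round_entry (a : nat * bool * (nat -> nat -> option feature))
  (o : nat * bool) : entry :=
  let: (x, y, psi) := a in
  Entry x y o.1 o.2 (if o.2 != y then psi x o.1 else None).

Fixpoint exp_mistakes (A : dff_alg) (adv : adversary) (n : nat) (S : interaction) : R :=
  match n with
  | 0 => 0%R
  | n'.+1 =>
      let a := adv S in
      (\sum_(wo <- A S a.1.1)
         wo.1 * ((wo.2.2 != a.1.2)%:R + exp_mistakes A adv n' (rcons S (round_entry a wo.2))))%R
  end.

Fixpoint all_runs (A : dff_alg) (adv : adversary) (P : interaction -> Prop)
  (n : nat) (S : interaction) : Prop :=
  match n with
  | 0 => P S
  | n'.+1 =>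
      let a := adv S in
      forall wo, List.In wo (A S a.1.1) -> (0 < wo.1 :> R)%R ->
        all_runs A adv P n' (rcons S (round_entry a wo.2))
  end.

Definition k_consistent (k : nat) (S : interaction) (T : teacher) : Prop :=
  exists E : list nat, (size E <= k)%N /\
    forall t, (t < size S)%N -> t \notin E ->
      let e := nth entry0 S t in
      T.1 (ex e) = ey e /\ (eyh e <> ey e -> T.2 (ex e) (exh e) = ephi e).

Definition admissible (L k : nat) (A : dff_alg) (TC : teacher_class) (H : history)
  (adv : adversary) : Prop :=
  all_runs A adv (fun S => exists T, restrict TC H T /\ k_consistent k S T) L [::].

Definition M_mistakes (L k : nat) (A : dff_alg) (TC : teacher_class) (H : history)
  : \bar R :=
  ereal_sup [set (exp_mistakes A adv L [::])%:E | adv in admissible L k A TC H].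

(* Main.v *)
(** A teacher is coded by a finite set [A] of positively labelled points and a finite set
[U] of quiet pairs.  Its feature for [(x, xh)] is the uninformative indicator of [x] when
[(x, xh)] is quiet, and otherwise reveals the whole code.  The constraint is that a point
[x], once it is quiet towards [H] (a "good" point), has at most [d - 2] quiet pairs
[(x', x)].

Realizable case: after a first mistake at [x1] explained by an example of [H], either the
teacher is revealed or [x1] is good; citing [x1] from then on, [d - 1] further mistakes
reveal the teacher.

Noisy case: the adversary presents fresh points, gives the label that makes a mistake more
likely, and always answers with the uninformative feature, until [N = (k + 1) (d - 1)]
mistakes have occurred.  Points [x] that seemed good but were cited in [d - 1] mistakes
are declared not good afterwards, at the price of the single entry in which [x] was
presented.  Each such [x] accounts for [d] mistakes of its own, so there are at most [k]. *)

Require Import Defs.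
From HB Require Import structures.
From mathcomp Require Import all_boot all_order all_algebra.
From mathcomp Require Import boolp classical_sets reals constructive_ereal ereal.
From mathcomp Require Import Rstruct.
From mathcomp Require Import zify lra.
From Stdlib Require Rdefinitions.
Import Order.TTheory GRing.Theory Num.Theory.

Set Implicit Arguments.
Unset Strict Implicit.
Unset Printing Implicit Defensive.

HB.instance Definition _ := gen_eqMixin entry.
HB.instance Definition _ := gen_eqMixin step.

Lemma List_InP (T : eqType) (x : T) (s : seq T) : reflect (List.In x s) (x \in s).
Proof.
elim: s => [|a s IH] /=; first by constructor.
rewrite in_cons; apply: (iffP orP) => -[].
- by move=> /eqP ->; left.
- by move=> /IH; right.
- by move=> ->; left.
- by move=> /IH; right.
Qed.

(** * Features and coded teachers *)

Definition silent (x : nat) : feature := fun z => z == x.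

(** The extra point exceeds [x] and [xh], so the values there are those of [silent x]; its position
    carries [n], later the pickled code of the teacher. *)
Definition telling (x xh n : nat) : feature :=
  fun z => (z == x) || (z == (x + xh + n).+1).

Lemma silent_telling x xh n : silent x <> telling x xh n.
Proof. by move=> /(congr1 (@^~ (x + xh + n).+1)); rewrite /silent /telling; lia. Qed.

Lemma telling_inj x xh : injective (telling x xh).
Proof.
move=> m n /(congr1 (@^~ (x + xh + m).+1)); rewrite /telling eqxx orbT; lia.
Qed.

Definition code : Type := (seq nat * seq (nat * nat))%type.

(* The points 1 and 2 of [H_bullet] are always quiet, so that the adversary can idle on
   them. *)
Definition quiet (c : code) (x xh : nat) : bool :=
  (x \in [:: 1; 2]) || ((x, xh) \in c.2).

Definition coded_teacher (c : code) : teacher :=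
  (fun x => x \in c.1,
   fun x xh => Some (if quiet c x xh then silent x else telling x xh (pickle c))).

Definition admissible_code (d : nat) (c : code) : Prop :=
  forall x, x \notin [:: 1; 2] -> quiet c x 1 || quiet c x 2 ->
  forall s, uniq s -> all (fun x' => (x' \notin [:: 1; 2]) && quiet c x' x) s ->
    (size s + 2 <= d)%N.

Definition coded_class (d : nat) : teacher_class :=
  fun T => exists2 c, admissible_code d c & T = coded_teacher c.

Lemma coded_class_teacher d : is_teacher_class (coded_class d).
Proof.
move=> _ [c _ ->] x xh /= neq; eexists; split; first by [].
have xxh : x <> xh by move=> e; rewrite e in neq.
by case: ifP => _; rewrite /silent /telling; lia.
Qed.

Lemma telling_determines c c' x xh :
  ~~ quiet c x xh -> (coded_teacher c).2 x xh = (coded_teacher c').2 x xh -> c = c'.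
Proof.
move=> /negbTE /= -> [].
case: ifP => _; first by move=> /esym/silent_telling.
by move=> /telling_inj/(pcan_inj pickleK).
Qed.

(** Children sit under [option], so their induction hypotheses are built by hand. *)
Fixpoint dfftree_nested_ind (P : dfftree -> Prop)
    (leaf : forall y phi, P (DLeaf y phi))
    (node : forall y phi x kid,
       (forall l c, kid l = Some c -> P c) -> P (DNode y phi x kid))
    (t : dfftree) : P t :=
  match t with
  | DLeaf y phi => leaf y phi
  | DNode y phi x kid => node y phi x kid (fun l c =>
      match kid l as o return o = Some c -> P c with
      | None => fun e => False_ind _ (eq_ind None (fun o => if o is None then True else False) I _ e)
      | Some c' => fun e =>
          eq_ind (Some c') (fun o => if o is Some c then P c else True)
            (dfftree_nested_ind leaf node c') (Some c) e
      end)
  end.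

(** * The realizable case: height of shattered trees *)

Section Dimension.
Variables (d h : nat) (t : dfftree).
Hypothesis sh : shattered (coded_class d) H_bullet t h.

Lemma reach_leaf c p : reach t p c ->
  exists q y phi, reach t (p ++ q) (DLeaf y phi).
Proof.
have [[_ _ _ ne] _ _ _ _] := sh.
elim/dfftree_nested_ind: c p => [y phi|y phi x kid IH] p rp.
  by exists [::], y, phi; rewrite cats0.
have [l] := ne _ _ _ _ _ rp.
case kl: (kid l) => [c|//] _.
have [q [y' [phi' rq]]] := IH l c kl _ (reach_step rp kl).
by eexists; exists y', phi'; rewrite -cats1 -catA in rq; apply: rq.
Qed.

Lemma reach_teacher p c : reach t p c ->
  exists cd, [/\ admissible_code d cd,
    consistent_with (coded_teacher cd) H_bullet & path_consistent (coded_teacher cd) p].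
Proof.
move=> /reach_leaf[q [y [phi rq]]]; have [_ _ _ con _] := sh.
have [_ [[[cd ad ->] conH] conp]] := con _ _ _ rq.
exists cd; split=> // s /List_InP sp; apply: conp; apply/List_InP.
by rewrite mem_cat sp.
Qed.

Lemma reach_node p c : reach t p c -> (size p < h)%N ->
  exists y phi x kid, c = DNode y phi x kid.
Proof.
case: c => [y phi|y phi x kid] rp; last by do 4!eexists.
have [_ _ _ _ hl] := sh; by rewrite (hl _ _ _ rp) ltnn.
Qed.

(** Shattering forces a mistake along the edge, and a teacher consistent with the path makes the
    label of the child a genuine bit. *)
Lemma reach_edge p y phi x kid l : reach t p (DNode y phi x kid) ->
  List.In l H_bullet \/ List.In (l.1, Some l.2) (labeled p) ->
  exists c, reach t (rcons p (Step x l (Some (~~ l.2)) (node_phi c))) c.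
Proof.
move=> rp /(proj2 (let: And5 _ _ e _ _ := sh in e _ _ _ _ _ rp l)).
case kl: (kid l) => [c|//] _; exists c.
have rc := reach_step rp kl.
have [_ ner _ _ _] := sh; have /= ne := ner _ _ _ rc.
have [cd [_ _ /(_ (Step x l (node_y c) (node_phi c)))[]]] := reach_teacher rc.
  by apply/List_InP; rewrite mem_rcons mem_head.
move=> /= e _; suff <- : node_y c = Some (~~ l.2) by [].
by move: ne; rewrite -e; case: (_ \in _) => /=; case: l.2 => // /(_ erefl).
Qed.

(** [H_bullet] contains both labels, so at every inner node a mistake against one of its examples
    can force either label on [x]. *)
Lemma reach_fork p y phi x kid b : reach t p (DNode y phi x kid) ->
  exists cd, [/\ admissible_code d cd,
    consistent_with (coded_teacher cd) H_bullet, path_consistent (coded_teacher cd) p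
    & (x \in cd.1) = b].
Proof.
move=> rp.
pose l := if b then (2, false) else (1, true).
have [|c rc] := reach_edge (l := l) rp; first by rewrite /l; left; case: (b) => /=; auto.
have [cd [ad conH conp]] := reach_teacher rc.
exists cd; split=> //.
  by move=> s /List_InP sp; apply: conp; apply/List_InP; rewrite mem_rcons inE sp orbT.
have [|/= [->] _] := conp (Step x l (Some (~~ l.2)) (node_phi c)).
  by apply/List_InP; rewrite mem_rcons mem_head.
by rewrite /l; case: (b).
Qed.

(** A point already labelled by the path or by [H_bullet] could not take both labels, against
    [reach_fork]. *)
Lemma reach_fresh p c : reach t p c ->
  uniq (map px p) && all (fun x => x \notin [:: 1; 2]) (map px p).
Proof.
elim=> // {c}p y phi x kid l c rp /andP[up ap] _.
have [T [_ TH Tp Tx]] := reach_fork true rp.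
have [T' [_ TH' Tp' Tx']] := reach_fork false rp.
rewrite map_rcons rcons_uniq up all_rcons ap !andbT /=; apply/andP; split.
  apply/negP => /mapP[s /List_InP sp xs].
  have [] := (Tp s sp, Tp' s sp) => -[e _] [e' _].
  by move: e'; rewrite -e -xs /= Tx Tx'.
rewrite !inE; apply/negP => /orP[] /eqP e; subst x.
  by have := TH' (1, true); rewrite /= Tx' => /(_ (or_intror (or_introl erefl))).
by have := TH (2, false); rewrite /= Tx => /(_ (or_introl erefl)).
Qed.

(** The path to follow: cite [(1, true)] once, then always the first example. *)
Lemma reach_spine j : (j < h)%N ->
  exists x1 phi1 q c, [/\ reach t (Step x1 (1, true) (Some false) phi1 :: q) c,
    size q = j & forall s, s \in q -> lbl s = (x1, false) /\ cy s = Some true].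
Proof.
elim: j => [|j IH] jh.
  have [y [phi [x [kid tE]]]] := reach_node (reach_root t) jh.
  have r0 := reach_root t; rewrite {2}tE in r0.
  have [|c rc] := reach_edge (l := (1, true)) r0; first by left; right; left.
  by exists x, (node_phi c), [::], c.
have [x1 [phi1 [q [c [rc sq Hq]]]]] := IH (ltnW jh).
have [|y [phi [x [kid cE]]]] := reach_node rc; first by rewrite /= sq.
rewrite cE in rc.
have [|c' rc'] := reach_edge (l := (x1, false)) rc; first by right; left.
exists x1, phi1, (rcons q (Step x (x1, false) (Some true) (node_phi c'))), c'.
split=> //; first by rewrite size_rcons sq.
by move=> s; rewrite mem_rcons inE => /orP[/eqP ->|/Hq].
Qed.

Lemma shattered_height : (2 <= d)%N -> (h <= d)%N.
Proof.
move=> d2; rewrite leqNgt; apply/negP => dh.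
(* One edge citing [(1, true)] and [d - 1] citing [x1]: a node at depth [d < h], hence inner. *)
have [|x1 [phi1 [q [c [rc sq Hq]]]]] := reach_spine (j := d.-1); first by lia.
have [|y [phi [x [kid cE]]]] := reach_node rc; first by rewrite /= sq; lia.
rewrite cE in rc.
have /andP[/= /andP[_ uq] /andP[x1n aq]] := reach_fresh rc.
have [T [Tad _ Tp Tx]] := reach_fork true rc.
have [T' [_ _ Tp' Tx']] := reach_fork false rc.
(* A non-quiet pair on the path reveals the code, so [T = T']. If all were quiet, [x1] would be good
   with [d - 1] quiet pairs, one too many. *)
suff e : T = T' by rewrite e Tx' in Tx.
have [x1q|] := boolP (quiet T x1 1); last first.
  move=> /telling_determines; apply.
  have [_ /= -> //] := Tp _ (or_introl erefl).
  by have [_ /= ->] := Tp' _ (or_introl erefl).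
have [aqu|/allPn[x' /mapP[s sq' ->] nq]] :=
    boolP (all (fun x' => quiet T x' x1) (map px q)).
  have := Tad x1 x1n _ _ uq; rewrite x1q all_predI aq aqu size_map => /(_ erefl erefl).
  by rewrite sq; lia.
apply: (telling_determines nq).
have [ls cs] := Hq s sq'.
have sin : List.In s (Step x1 (1, true) (Some false) phi1 :: q).
  by right; apply/List_InP.
have [_] := Tp _ sin; have [_] := Tp' _ sin.
by rewrite ls cs /= => -> // ->.
Qed.

End Dimension.

(** * The noisy case: a teacher read off the interaction *)

Definition missed (e : entry) : bool := eyh e != ey e.

Definition live (e : entry) : bool := missed e && (2 < ex e)%N.

(** Keeping this pair quiet would make [ex e] good although [d - 1] live mistakes cite it. *)
Definition refuted (d : nat) (S : interaction) (e : entry) : bool :=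
  [&& live e, exh e \in [:: 1; 2]
    & (d <= (count (fun e' => live e' && (exh e' == ex e)) S).+1)%N].

(** The leading [1] serves the example [(1, true)] of [H_bullet]. *)
Definition code_of (d : nat) (S : interaction) : code :=
  (1 :: [seq ex e | e <- S & ey e],
   [seq (ex e, exh e) | e <- S & missed e && ~~ refuted d S e]).

(** Invariant of the adversary's play; the second clause keeps [size S + 3] fresh, and the third
    allows old points only as the idle example. *)
Definition stalled (N : nat) (S : interaction) : Prop :=
  [/\ uniq [seq ex e | e <- S & (2 < ex e)%N],
      forall e, e \in S -> (ex e < size S + 3)%N,
      forall e, e \in S -> (2 < ex e)%N \/ ex e = 1 /\ ey e,
      forall e, e \in S -> missed e -> ephi e = Some (silent (ex e))
    & (count live S <= N)%N].

Lemma uniq_map_inj (T1 T2 : eqType) (f : T1 -> T2) s :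
  uniq (map f s) -> {in s &, injective f}.
Proof.
elim: s => //= x s IH /andP[fx /IH inj] a b.
rewrite !inE => /predU1P[->|sa] /predU1P[->|sb] // e; last exact: inj.
  by rewrite e map_f in fx.
by rewrite -e map_f in fx.
Qed.

Lemma stalled_inj N S e e' : stalled N S -> e \in S -> e' \in S ->
  (2 < ex e)%N -> ex e = ex e' -> e = e'.
Proof.
move=> [u _ _ _ _] eS eS' x2 ee.
by apply: (uniq_map_inj u) => //; rewrite mem_filter ?x2 // -ee x2.

Qed.

Lemma mem_code_labels N d S e : stalled N S -> e \in S ->
  (ex e \in (code_of d S).1) = ey e.
Proof.
move=> st eS; have [_ _ /(_ e eS)[x2|[-> ->]] _ _] := st; last by [].
rewrite inE gtn_eqF ?(ltnW x2) //=.
apply/mapP/idP => [[e']|ye]; last by exists e; rewrite // mem_filter ye.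
by rewrite mem_filter => /andP[y' eS'] /(stalled_inj st eS eS' x2) ->.
Qed.

(** The entry presenting a good point is not refuted, so at most [d - 2] live mistakes cite that
    point, and its quiet pairs come from these. *)
Lemma code_of_admissible N d S : (2 <= d)%N -> stalled N S ->
  admissible_code d (code_of d S).
Proof.
move=> d2 st x xn; rewrite /quiet (negbTE xn) /= => xq s us qs.
have [e [eS ex_e me ne eh]] : exists e, [/\ e \in S, ex e = x, missed e,
    ~~ refuted d S e & exh e \in [:: 1; 2]].
  case/orP: xq => /mapP[e]; rewrite mem_filter => /andP[/andP[me ne] eS] [-> he];
  by exists e; split; rewrite // -he.
have x2 : (2 < ex e)%N.
  by have [_ _ /(_ e eS)[//|[e1 _]] _ _] := st; rewrite -ex_e e1 in xn.
move: ne; rewrite /refuted /live me x2 eh /= -ltnNge; apply: leq_trans.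
rewrite addn2 !ltnS -size_filter -(size_map ex).
apply: uniq_leq_size us _ => x' /(allP qs) /andP[xn'].
rewrite (negbTE xn') /= => /mapP[e']; rewrite mem_filter => /andP[/andP[me' _] eS'] [xe' he'].
apply/mapP; exists e' => //; rewrite mem_filter /live me' -he' ex_e eqxx eS' !andbT.
by have [_ _ /(_ e' eS')[//|[e1 _]] _ _] := st; rewrite xe' e1 in xn'.
Qed.

Lemma leq_card_fibres (T : Type) (f : T -> nat) d vs (M : seq T) : uniq vs ->
  (forall v, v \in vs -> (d <= count (fun e => f e == v) M)%N) ->
  (d * size vs <= size M)%N.
Proof.
elim: vs M => [|v vs IH] M /=; first by rewrite muln0.
move=> /andP[vn u] H; rewrite mulnS -(count_predC (fun e => f e == v) M).
apply: leq_add; first by apply: H; rewrite mem_head.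
rewrite -size_filter; apply: IH => // w wv.
rewrite count_filter; apply: leq_trans (H w _) _; first by rewrite inE wv orbT.
apply: sub_count => e /= /eqP ->; rewrite eqxx /=.
by apply: contraNneq vn => <-.
Qed.

(* A refuted entry owns itself and the [d - 1] live entries that cite it. *)
Definition owner (e : entry) : nat := if exh e \in [:: 1; 2] then ex e else exh e.

Lemma leq_refuted k d S : (2 <= d)%N -> stalled ((k + 1) * (d - 1)) S ->
  (count (refuted d S) S <= k)%N.
Proof.
move=> d2 st; have [us _ _ _ cN] := st.
(* With [r] refuted entries, [d r <= (k + 1) (d - 1) < (k + 1) d] gives [r <= k]. *)
suff : (d * count (refuted d S) S <= count live S)%N by nia.
rewrite -!size_filter -(size_map ex); apply: (leq_card_fibres (f := owner)).
  apply: subseq_uniq us; apply: map_subseq.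
  rewrite (_ : [seq e <- S | refuted d S e] =
    [seq e <- [seq e <- S | (2 < ex e)%N] | refuted d S e]) ?filter_subseq //.
  rewrite -filter_predI; apply: eq_filter => e /=.
  by rewrite /refuted /live; case: (2 < ex e)%N; rewrite ?andbF ?andbT.
move=> v /mapP[e]; rewrite mem_filter => /andP[/and3P[le eh dc] eS] ->.
apply: leq_trans dc _.
set cites := fun e' => live e' && (exh e' == ex e).
(* Inclusion-exclusion: [e] cites 1 or 2 rather than its own point, so it is not among [cites] and
   adds at least one to the union. *)
have -> : (count cites S).+1 = (count (predU cites (pred1 e)) S
    + count (predI cites (pred1 e)) S - count (pred1 e) S).+1.
  by rewrite count_predUI addnK.
rewrite (@eq_count _ (predI cites _) pred0) ?count_pred0; last first.
  move=> e' /=; apply/negbTE; apply/negP => /andP[/andP[_ /eqP xx] /eqP ee].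
  by move: le eh; rewrite /live ee in xx * => /andP[_ x2]; rewrite xx !inE; lia.
have c1 : (0 < count (pred1 e) S)%N by rewrite -has_count has_pred1.
have cU : (count (pred1 e) S <= count (predU cites (pred1 e)) S)%N.
  by apply: sub_count => e' /= ->; rewrite orbT.
rewrite addn0; apply: (@leq_trans (count (predU cites (pred1 e)) S)); first by lia.
rewrite count_filter; apply: sub_count => e' /=.
case/orP => [/andP[le' /eqP xx]|/eqP ->]; last by rewrite /owner eh eqxx.
rewrite le' andbT /owner ifN xx //.
by move: le; rewrite /live !inE; lia.
Qed.

(** The exceptional rounds are the refuted entries; every other mistaken pair is quiet, matching the
    silent feature that was given. *)
Lemma stalled_consistent k d S : (2 <= d)%N -> stalled ((k + 1) * (d - 1)) S ->
  exists T, restrict (coded_class d) H_bullet T /\ k_consistent k S T.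
Proof.
move=> d2 st; exists (coded_teacher (code_of d S)); split.
  split; first by exists (code_of d S) => //; apply: code_of_admissible st.
  move=> _ [<-|[<-|[]]] //=; rewrite inE /=; apply/mapP => -[e].
  rewrite mem_filter => /andP[_ eS]; have [_ _ /(_ e eS) + _ _] := st.
  by case=> [|[-> _]] // /[swap] <-.
exists [seq i <- iota 0 (size S) | refuted d S (nth entry0 S i)]; split.
  rewrite size_filter -(count_map (nth entry0 S) (refuted d S)).
  by rewrite map_nth_iota0 // take_size; apply: leq_refuted.
move=> i iS; rewrite mem_filter mem_iota add0n iS /= andbT => ni.
have eS := mem_nth entry0 iS.
split; first exact: mem_code_labels st eS.
move=> /eqP me; have [_ _ _ /(_ _ eS me) -> _] := st.
rewrite /= /quiet (_ : (_, _) \in _) ?orbT //.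
by apply/mapP; exists (nth entry0 S i) => //; rewrite mem_filter /missed me ni.
Qed.

Local Open Scope ring_scope.

(** * The stalling adversary and its expected number of mistakes *)

Section Adversary.
Variables (N : nat) (A : dff_alg).
Hypothesis vA : valid_alg H_bullet A.

Definition error_weight (S : interaction) (x : nat) (b : bool) : R :=
  \sum_(wo <- A S x) wo.1 * (wo.2.2 != b)%:R.

(* Out of budget, it idles on the example (1, true) of [H_bullet]. *)
Definition stalling : adversary := fun S =>
  if (count live S < N)%N
  then let x := (size S + 3)%N in
    (x, ~~ (1 / 2 <= error_weight S x false), fun x _ => Some (silent x))
  else (1%N, true, fun x _ => Some (silent x)).

(** The error probabilities under the two labels sum to 1, and the adversary picks a label with the
    larger one. *)
Lemma error_weight_stalling S : (count live S < N)%N ->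
  1 / 2 <= error_weight S (stalling S).1.1 (stalling S).1.2.
Proof.
rewrite /stalling => -> /=; set x := (_ + 3)%N.
have : error_weight S x false + error_weight S x true = 1.
  rewrite -big_split /=; have [_ w1] := vA S x; apply: etrans w1; apply: eq_bigr => wo _.
  by case: wo.2.2; rewrite /= mulr1 mulr0 ?addr0 ?add0r.
by case: (leP _ (error_weight S x false)) => //=; lra.
Qed.

Lemma stalled_rcons S o : stalled N S -> stalled N (rcons S (round_entry (stalling S) o)).
Proof.
move=> [u lt ge sil cN].
have count1 e : count live (rcons S e) = (count live S + live e)%N.
  by rewrite -cats1 count_cat /= addn0.
have uS3 : (size S + 3)%N \notin [seq ex e | e <- S & (2 < ex e)%N].
  apply/mapP => -[e]; rewrite mem_filter => /andP[_ /lt] /[swap] <-.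
  by rewrite ltnn.
rewrite /stalling; case: ifP => cSN; split.
- by rewrite filter_rcons /= ifT ?map_rcons ?rcons_uniq ?uS3 //; lia.
- move=> e; rewrite mem_rcons inE size_rcons => /orP[/eqP -> /=|/lt]; lia.
- by move=> e; rewrite mem_rcons inE => /orP[/eqP -> /=|/ge //]; left; lia.
- move=> e; rewrite mem_rcons inE => /orP[/eqP ->|/sil //].
  by rewrite /missed /= => ->.
- by rewrite count1; case: (live _); lia.
- by rewrite filter_rcons /=.
- move=> e; rewrite mem_rcons inE size_rcons => /orP[/eqP -> /=|/lt]; lia.
- by move=> e; rewrite mem_rcons inE => /orP[/eqP -> /=|/ge //]; right.
- move=> e; rewrite mem_rcons inE => /orP[/eqP ->|/sil //].
  by rewrite /missed /= => ->.
- by rewrite count1 /live /= andbF addn0.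
Qed.

Lemma all_runs_stalling (P : interaction -> Prop) n S :
  (forall S, stalled N S -> P S) -> stalled N S -> all_runs A stalling P n S.
Proof.
move=> NP; elim: n S => [|n IH] S st /=; first exact: NP.
by move=> wo _ _; apply: IH; apply: stalled_rcons.
Qed.

Lemma exp_mistakes_ge0 adv n S : 0 <= exp_mistakes A adv n S.
Proof.
elim: n S => //= n IH S; rewrite big_seq; apply: sumr_ge0 => wo /List_InP.
have [/(_ wo) H _] := vA S (adv S).1.1; move=> /H[w0 _].
by rewrite mulr_ge0 ?addr_ge0.
Qed.

(* With [m] live mistakes to go, each one occurring with probability at least
   1/2 per round, the expected shortfall after [n] rounds is at most
   [2^m (3/4)^n]: this potential satisfies [(2^(m-1) + 2^m) / 2 = 3/4 * 2^m]. *)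
Lemma exp_mistakes_stalling n S :
  (N - count live S)%:R - 2 ^+ (N - count live S) * (3 / 4) ^+ n
    <= exp_mistakes A stalling n S.
Proof.
elim: n S => [|n IH] S /=.
  rewrite expr0 mulr1 subr_le0 -natrX ler_nat; exact/ltnW/ltn_expl.
have [cN|cN] := ltnP (count live S) N; last first.
  rewrite (_ : (_ - _)%N = 0%N); last by apply/eqP.
  rewrite expr0 mul1r sub0r; apply: (@le_trans _ _ 0).
    by rewrite oppr_le0 exprn_ge0 //; lra.
  exact: (exp_mistakes_ge0 stalling n.+1).
set m := (N - _)%N; set a := stalling S.
have m0 : (0 < m)%N by rewrite subn_gt0.
set B : R := (3 / 4) ^+ n; have B0 : 0 <= B by rewrite exprn_ge0 //; lra.
have p2 := error_weight_stalling cN; rewrite -/a in p2.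
have [w0 w1] := vA S a.1.1.
(* The induction hypothesis as an affine function of the mistake indicator: a mistake halves
   [2 ^+ m * B], while its gain of 1 makes up for the drop of [m]. *)
apply: (@le_trans _ _ (\sum_(wo <- A S a.1.1)
    wo.1 * (m%:R - 2 ^+ m * B + 2 ^+ m * B / 2 * (wo.2.2 != a.1.2)%:R))).
  under eq_bigr do rewrite mulrDr mulrCA.
  rewrite big_split /= -mulr_suml w1 -mulr_sumr -/(error_weight _ _ _) exprS -/B.
  have : 0 <= 2 ^+ m * B by rewrite mulr_ge0 // exprn_ge0.
  by nra.
rewrite big_seq [leRHS]big_seq; apply: ler_sum => wo /List_InP/w0[wo0 _].
apply: ler_wpM2l => //.
apply: le_trans (lerD (lexx _) (IH _)).
rewrite -cats1 count_cat /= addn0.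
have -> : live (round_entry a wo.2) = (wo.2.2 != a.1.2).
  by rewrite /a /stalling cN /live /missed /=; lia.
case: (wo.2.2 != _) => /=; last by rewrite addn0 mulr0 addr0 add0r.
rewrite subnDA -/m; case: m m0 => // m _; rewrite subn1 /= exprS mulr1 -(natr1 m) -/B.
by lra.
Qed.

End Adversary.

(** Four rounds per mistake suffice because [2 (3/4)^4 = 81/128 < 1]. *)
Lemma shortfall_le1 (F : realFieldType) N L : (4 * N <= L)%N ->
  2 ^+ N * (3 / 4) ^+ L <= 1 :> F.
Proof.
move=> NL; apply: (@le_trans _ _ (2 ^+ N * ((3 / 4) ^+ 4) ^+ N)).
  rewrite ler_wpM2l ?exprn_ge0 // -exprM; apply: ler_wiXn2l => //; lra.
by rewrite -exprMn exprn_ile1 //; lra.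
Qed.

Theorem mainTheorem14 :
  forall d : nat, (2 <= d)%N ->
  exists TC : teacher_class,
    is_teacher_class TC /\
    DFFdim_le TC H_bullet d /\
    (forall k L : nat, (1 <= k)%N -> (4 * (k + 1) * d <= L)%N ->
      forall A : dff_alg, valid_alg H_bullet A ->
        ((((k + 1) * d)%:R - k%:R - 2%:R : R)%:E <= M_mistakes L k A TC H_bullet)%E).
Proof.
move=> d d2; exists (coded_class d); split; first exact: coded_class_teacher.
split=> [t h sh|k L k1 hL A vA]; first exact: shattered_height sh d2.
pose N := ((k + 1) * (d - 1))%N.
apply: (@le_trans _ _ (exp_mistakes A (stalling N A) L [::])%:E); last first.
  apply: ereal_sup_ubound; exists (stalling N A) => //.
  by apply: all_runs_stalling => // S; apply: stalled_consistent.
rewrite lee_fin; apply: le_trans (exp_mistakes_stalling N vA L [::]).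
rewrite /= subn0.
have := @shortfall_le1 R N L; rewrite (_ : (4 * N <= L)%N); last by rewrite /N; nia.
move=> /(_ erefl).
(* The target is [N - 1], the 1 being the bound on the shortfall. *)
have -> : (((k + 1) * d)%N = N + k + 1)%N by rewrite /N; nia.
by rewrite !natrD; lra.
Qed.
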